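(* Let $\alpha>0$. For $x\ge0$ and $u\ge0$ consider the discounted cost functional $$J_\alpha(x,u)=E\Bigl(\int_0^\infty e^{-\alpha t}\bigl[h(u)+C\bigl(X_x^u(t)\bigr)\bigr]\,dt+\int_0^\infty e^{-\alpha t}p\,dL_x^u(t)\Bigr).$$ Then, for each initial point $x\ge 0$, there is an optimal control $u^*\ge 0$ such that $$J_\alpha(x,u^* )=\inf_{u\ge0}J_\alpha(x,u)=V_\alpha(x),$$ where $V_\alpha(x)=\inf_{u>0}J_\alpha(x,u)$ is the value function of the discounted cost problem.
   Context: Let $H\in[\tfrac12,1)$ and let $W_H=(W_H(t))_{t\ge 0}$ be a fractional Brownian motion with Hurst parameter $H$: a continuous zero-mean Gaussian process with $W_H(0)=0$ and $\mathrm{Cov}(W_H(s),W_H(t))=\frac12\bigl[t^{2H}+s^{2H}-|t-s|^{2H}\bigr]$ for $s,t\ge 0$. For $x\ge 0$ and $u\ge 0$ define, for $t\ge 0$, $$L_x^u(t)=-\min\Bigl\{0,\min_{s\in[0,t]}\bigl(x-us+W_H(s)\bigr)\Bigr\},\qquad X_x^u(t)=x-ut+W_H(t)+L_x^u(t).$$ $L_x^u$ is continuous and non-decreasing, and $dL_x^u$ denotes the Riemann–Stieltjes integrator. Standing assumptions: $p\ge 0$ is a constant; $h:[0,\infty)\to[0,\infty)$ is continuous, non-decreasing, convex, with $\lim_{u\to\infty}h(u)=+\infty$; $C:[0,\infty)\to[0,\infty)$ is continuous, non-decreasing, convex, and satisfies $C(y)\le K(1+y^\gamma)$ for all $y\ge0$,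 for some constants $K>0$, $\gamma>0$. *)

(* Defs.v *)
From HB Require Import structures.
From mathcomp Require Import all_boot all_order all_algebra.
From mathcomp Require Import all_classical all_reals all_analysis.

Set Implicit Arguments.
Unset Strict Implicit.
Unset Printing Implicit Defensive.

Import Order.TTheory GRing.Theory Num.Theory.
Import numFieldNormedType.Exports.

Local Open Scope classical_set_scope.
Local Open Scope ring_scope.

(* The library's [normal_prob m 0] is a uniform law; the normal law with zero
   variance is the Dirac mass at [m]. *)
Definition is_gaussian (R : realType) (d : measure_display)
    (T : measurableType d) (P : probability T R) (X : T -> R) : Prop :=
  exists m s : R, forall A : set R, measurable A ->
    P (X @^-1` A) = if s == 0 then \d_m A else normal_prob m s A.

(* Only times [t >= 0] are constrained; [W t] for [t < 0] is irrelevant. *)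
Record fractional_brownian_motion (R : realType) (d : measure_display)
    (T : measurableType d) (P : probability T R) (H : R)
    (W : R -> {RV P >-> R}) : Prop := FractionalBrownianMotion {
  fbm_continuous : forall om : T,
    {within `[0, +oo[, continuous (fun t => W t om)};
  fbm_start : forall om : T, W 0 om = 0;
  fbm_gaussian : forall (n : nat) (t a : 'I_n -> R),
    (forall i, 0 <= t i) ->
    is_gaussian P (fun om => \sum_(i < n) a i * W (t i) om);
  fbm_mean : forall t : R, 0 <= t -> expectation P (W t) = 0%E;
  fbm_cov : forall s t : R, 0 <= s -> 0 <= t ->
    covariance P (W s) (W t) =
      (2^-1 * (t `^ (2 * H) + s `^ (2 * H) - `|t - s| `^ (2 * H)))%:E
}.

(* [w] is a path of the driving process. For a continuous path the infimum
   over [0, t] is attained, so it is the minimum. *)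
Definition regulator (R : realType) (w : R -> R) (x u t : R) : R :=
  - Num.min 0 (inf [set x - u * s + w s | s in `[0, t]]).

Definition reflected (R : realType) (w : R -> R) (x u t : R) : R :=
  x - u * t + w t + regulator w x u t.

Definition RS_sum (R : realType) (f g : R -> R) (a b : R) (s : seq R)
    (tag : nat -> R) : R :=
  \sum_(0 <= i < size s)
    f (tag i) * (g (nth b (a :: s) i.+1) - g (nth b (a :: s) i)).

Definition is_RS_integral (R : realType) (f g : R -> R) (a b I : R) : Prop :=
  forall eps : R, 0 < eps -> exists2 delta : R, 0 < delta &
    forall (s : seq R) (tag : nat -> R),
      itv_partition a b s ->
      (forall i, (i < size s)%N ->
        nth b (a :: s) i.+1 - nth b (a :: s) i < delta /\
        nth b (a :: s) i <= tag i <= nth b (a :: s) i.+1) ->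
      `|RS_sum f g a b s tag - I| < eps.

(* Total version, with value 0 when the integral does not exist. *)
Definition RS_integral (R : realType) (f g : R -> R) (a b : R) : R :=
  xget 0 [set I | is_RS_integral f g a b I].

Definition RS_integral_infty (R : realType) (f g : R -> R) (a : R) : \bar R :=
  lim ((RS_integral f g a b)%:E @[b --> +oo%R]).

(* Both summands are nonnegative, so the cost is a well-defined element of
   [0, +oo]. *)
Definition discounted_cost (R : realType) (d : measure_display)
    (T : measurableType d) (P : probability T R) (W : R -> {RV P >-> R})
    (h C : R -> R) (p alpha x u : R) : \bar R :=
  (\int[P]_om
     ((\int[lebesgue_measure]_(t in `[0%R, +oo[)
        (expR (- (alpha * t)) *
           (h u + C (reflected (fun s => W s om) x u t)))%:E)
      + RS_integral_infty (fun t => expR (- (alpha * t)) * p)%R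
          (fun t => regulator (fun s => W s om) x u t) 0%R))%E.

Definition value_function (R : realType) (d : measure_display)
    (T : measurableType d) (P : probability T R) (W : R -> {RV P >-> R})
    (h C : R -> R) (p alpha x : R) : \bar R :=
  ereal_inf [set discounted_cost W h C p alpha x u | u in [set u : R | 0 < u]].

(* Main.v *)
Require Import Defs.
From HB Require Import structures.
From mathcomp Require Import all_boot all_order all_algebra.
From mathcomp Require Import all_classical all_reals all_analysis.
From mathcomp Require Import measurable_realfun.
From mathcomp Require Import ring lra.

(** The argument compares the costs of different drifts path by path.

    Let [L^u] be the regulator and [X^u] the reflected path.  By
    [regulator_leP], [L^u(t)] is the least upper bound of zero and of the
    numbers [u s - x - w(s)] with [s <= t].  Hence, for [u <= v],
    [L^u(t) <= L^v(t) <= L^u(t) + (v - u) t], and the second inequality is the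
    same as [X^v(t) <= X^u(t)].  Integration by parts
    ([RS_integral_infty_discount]) turns the control cost into the Lebesgue
    integral of [alpha p e^(- alpha t) L^u(t)], an identity in [0, +oo], so that
    [J(u)] is a double integral of the nonnegative function [cost_density u].

    - This density is jointly measurable and continuous in [u].  Applying
      Fatou's lemma in time and then over the sample space shows that [J] has
      closed sublevel sets ([discounted_cost_closed_sublevel]).
    - Keeping only the running cost [h] gives [J(u) >= h(u) / alpha], so [J] is
      coercive ([discounted_cost_lower_bound]).  A coercive function with
      closed sublevel sets attains its infimum on the half-line
      ([closed_sublevel_coercive_attains_inf]).
    - Comparing the drifts [0] and [u] gives
      [J(u) <= J(0) + (h(u) - h(0)) / alpha + 4 p u / alpha]
      ([discounted_cost_drift_bound]): the holding cost decreases with the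
      drift, and the regulator grows by at most [u t].  Letting [u] decrease
      to zero, the infimum over positive drifts is at most [J(0)], hence equal
      to the infimum over all nonnegative drifts. *)

Set Implicit Arguments.
Unset Strict Implicit.
Unset Printing Implicit Defensive.

Import Order.TTheory GRing.Theory Num.Theory.
Import numFieldNormedType.Exports.

Local Open Scope classical_set_scope.
Local Open Scope ring_scope.

(** * Pathwise properties of the regulator *)

Section Regulator.
Context (R : realType) (w : R -> R) (x : R).
Hypothesis cw : {within `[0, +oo[, continuous w}.

(** All properties of the regulator below follow from this description of the
    upper bounds of [regulator w x u t], which needs the infimum in its
    definition to be a genuine one: a continuous path is bounded below on the
    compact interval [0, t]. *)
Lemma regulator_leP (u t c : R) : 0 <= t ->
  regulator w x u t <= c <->
  0 <= c /\ forall s, 0 <= s <= t -> u * s - x - w s <= c.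
Proof.
move=> t0; set S := [set x - u * s + w s | s in `[0, t]].
have cf : {within `[0, t], continuous (fun s => x - u * s + w s)}.
  have cl : {within `[0, t], continuous (fun s => x - u * s)}.
    apply: continuous_subspaceT => s; apply: cvgB; first exact: cvg_cst.
    by apply: cvgM; [exact: cvg_cst|exact: cvg_id].
  have ct : {within `[0, t], continuous w}.
    by apply: (continuous_subspaceW _ cw) => z /=; rewrite !in_itv/= => /andP[->].
  by move=> s; apply: cvgD; [exact: cl|exact: ct].
have [s0 _ Hs0] := EVT_min t0 cf.
have infS : has_inf S.
  split; first by exists (x - u * 0 + w 0), 0 => //=; rewrite in_itv/= lexx.
  by exists (x - u * s0 + w s0) => _ /= [s sI <-]; exact: Hs0.
rewrite /regulator -/S lerNl le_min oppr_le0; split.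
  move=> /andP[c0 cS]; split=> // s st.
  have := le_trans cS (ge_inf infS.2 _).
  move=> /(_ (x - u * s + w s)) H.
  have : - c <= x - u * s + w s by apply: H; exists s.
  by lra.
move=> [-> H] /=; apply: lb_le_inf; first exact: infS.1.
by move=> _ /= [s /H + <-]; lra.
Qed.

Lemma regulator_ge0 (u t : R) : 0 <= t -> 0 <= regulator w x u t.
Proof. by move=> t0; have /regulator_leP-/(_ t0)[] := lexx (regulator w x u t). Qed.

Lemma le_regulator_path (u t s : R) : 0 <= s <= t ->
  u * s - x - w s <= regulator w x u t.
Proof.
move=> st; have t0 : 0 <= t by case/andP: st => /le_trans; exact.
by have /regulator_leP-/(_ t0)[_] := lexx (regulator w x u t); exact.
Qed.

Lemma reflected_ge0 (u t : R) : 0 <= t -> 0 <= reflected w x u t.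
Proof.
move=> t0; have : u * t - x - w t <= regulator w x u t.
  by apply: le_regulator_path; rewrite t0 lexx.
by rewrite /reflected; lra.
Qed.

Lemma regulator_nondecreasing (u s t : R) : 0 <= s -> s <= t ->
  regulator w x u s <= regulator w x u t.
Proof.
move=> s0 st; have t0 := le_trans s0 st.
apply/(regulator_leP _ _ s0); split; first exact: regulator_ge0.
move=> r /andP[r0 rs]; apply: le_regulator_path; rewrite r0/=.
exact: le_trans st.
Qed.

Lemma regulator_start (u : R) : 0 <= x -> w 0 = 0 -> regulator w x u 0 = 0.
Proof.
move=> x0 w0; apply/eqP; rewrite eq_le regulator_ge0// andbT.
apply/regulator_leP => //; split=> // s; rewrite -eq_le => /eqP <-.
by rewrite w0 mulr0; lra.
Qed.

Lemma regulator_mono_drift (u v t : R) : u <= v -> 0 <= t ->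
  regulator w x u t <= regulator w x v t.
Proof.
move=> uv t0; apply/(regulator_leP _ _ t0); split; first exact: regulator_ge0.
move=> s st; have := le_regulator_path v st.
have : u * s <= v * s by apply: ler_wpM2r => //; case/andP: st.
by lra.
Qed.

(** Each candidate [v s - x - w s] exceeds [u s - x - w s] by [(v - u) s], which
    is at most [(v - u) t]. *)
Lemma regulator_drift_bound (u v t : R) : u <= v -> 0 <= t ->
  regulator w x v t <= regulator w x u t + (v - u) * t.
Proof.
move=> uv t0; have vut : 0 <= (v - u) * t by rewrite mulr_ge0// subr_ge0.
apply/(regulator_leP _ _ t0); split; first by rewrite addr_ge0// regulator_ge0.
move=> s st; have := le_regulator_path u st.
have : (v - u) * s <= (v - u) * t.
  by apply: ler_wpM2l; [rewrite subr_ge0|case/andP: st].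
by lra.
Qed.

(** A larger drift removes [(v - u) t] from the free path, and the regulator
    gives back at most that much. *)
Lemma reflected_anti_drift (u v t : R) : u <= v -> 0 <= t ->
  reflected w x v t <= reflected w x u t.
Proof.
move=> uv t0; have := regulator_drift_bound uv t0.
by rewrite /reflected; lra.
Qed.

Lemma regulator_continuous_drift (t : R) : 0 <= t ->
  continuous (fun u => regulator w x u t).
Proof.
move=> t0 u; apply/cvgrPdist_le => e e0.
have t1 : 0 < t + 1 by lra.
near=> v.
have uv : `|u - v| <= e / (t + 1).
  near: v; move: (e / (t + 1)) (divr_gt0 e0 t1) => e' e'0.
  by have /cvgrPdist_le/(_ e' e'0) := @cvg_id R (nbhs u).
suff H a b : a <= b -> `|regulator w x a t - regulator w x b t| <= `|a - b| * t.
  apply: (@le_trans _ _ (`|u - v| * t)).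
    have [/H//|/ltW vu] := leP u v.
    by rewrite distrC (distrC u v); exact: H.
  move: uv; rewrite ler_pdivlMr// mulrDr mulr1; have := normr_ge0 (u - v); lra.
move=> ab; have H1 := regulator_mono_drift ab t0.
have H2 := regulator_drift_bound ab t0.
rewrite distrC (distrC a b) !ger0_norm ?subr_ge0//; lra.
Unshelve. all: by end_near. Qed.

End Regulator.

(** * The exponential weight *)

Section ExponentialWeight.
Context (R : realType) (alpha : R).
Hypothesis alpha_gt0 : 0 < alpha.
Notation mu := (@lebesgue_measure R).

Lemma continuous_discount : continuous (fun t : R => expR (- (alpha * t))).
Proof.
move=> t; apply: continuous_comp; last exact: continuous_expR.
by apply: cvgN; apply: cvgM; [exact: cvg_cst|exact: cvg_id].
Qed.

Lemma measurable_discount (D : set R) :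
  measurable_fun D (fun t : R => expR (- (alpha * t))).
Proof.
by apply: measurable_funTS; apply: continuous_measurable_fun;
  exact: continuous_discount.
Qed.

Lemma integral_discount_tail (c : R) : 0 <= c ->
  (\int[mu]_(t in `[c, +oo[) (alpha * expR (- (alpha * t)))%:E =
   (expR (- (alpha * c)))%:E)%E.
Proof.
move=> c0; pose F (t : R) := - expR (- alpha * t).
have cF : continuous (fun t : R => expR (- alpha * t)).
  by move=> t; under eq_fun do rewrite mulNr; exact: continuous_discount.
rewrite (@ge0_continuous_FTC2y _ _ F _ 0)//.
- by rewrite /F EFinN oppeK add0e mulNr.
- by move=> t _; rewrite mulr_ge0 ?expR_ge0// ltW.
- apply: continuous_subspaceT => t; apply: cvgM; first exact: cvg_cst.
  exact: continuous_discount.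
- rewrite -oppr0; apply: cvgN; under eq_fun do rewrite mulNr.
  apply: (@cvg_comp _ _ _ (fun z => alpha * z) (fun z => expR (- z)) _
            (pinfty_nbhs R)); last exact: cvgr_expR.
  exact: gt0_cvgMry.
- by apply: cvgN; apply/cvg_at_right_filter; exact: cF.
- move=> t; rewrite in_itv/= andbT => ct; have t0 := le_lt_trans c0 ct.
  rewrite derive1_exponential_pdf ?in_itv/= ?t0//.
  by rewrite exponential_pdfE ?ltW// mulNr.
Qed.

End ExponentialWeight.

(** * Discounted Riemann-Stieltjes integrals *)

Section RiemannStieltjes.
Context (R : realType) (alpha p : R) (g : R -> R).
Hypothesis alpha_gt0 : 0 < alpha.
Hypothesis p_ge0 : 0 <= p.
Hypothesis g_nd : forall s t, 0 <= s -> s <= t -> g s <= g t.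
Hypothesis g0 : g 0 = 0.
Notation mu := (@lebesgue_measure R).
Notation disc := (fun t : R => expR (- (alpha * t))).

Lemma integral_discount_step (a c : R) : 0 <= a -> 0 <= c ->
  (\int[mu]_(t in `[0%R, +oo[) (alpha * disc t * (a * \1_(`[c, +oo[) t))%:E =
   (a * disc c)%:E)%E.
Proof.
move=> a0 c0.
under eq_integral do rewrite mulrCA EFinM.
rewrite ge0_integralZl//; last 2 first.
- apply/measurable_EFinP; apply: measurable_funM.
    by apply: measurable_funM => //; exact: measurable_discount.
  exact: measurable_indic.
- by move=> t _; rewrite lee_fin !mulr_ge0 ?expR_ge0// ltW.
rewrite EFinM -integral_discount_tail//; congr (_ * _)%E.
rewrite -[in RHS](@setIidr _ `[0, +oo[ `[c, +oo[); last first.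
  by move=> t /=; rewrite !in_itv/= !andbT; exact: le_trans.
rewrite integral_mkcondr; apply: eq_integral => t _.
by rewrite patchE indicE; case: ifPn => _; rewrite ?mulr1 ?mulr0.
Qed.

Lemma integral_discount_steps (n : nat) (a c : nat -> R) :
  (forall i, (i < n)%N -> 0 <= a i /\ 0 <= c i) ->
  (\int[mu]_(t in `[0%R, +oo[)
     (alpha * disc t * \sum_(0 <= i < n) a i * \1_(`[c i, +oo[) t)%:E =
   (\sum_(0 <= i < n) a i * disc (c i))%:E)%E.
Proof.
have mstep (b e : R) : measurable_fun (`[0%R, +oo[ : set R)
    (fun t => alpha * disc t * (b * \1_(`[e, +oo[) t)).
  apply: measurable_funM.
    by apply: measurable_funM => //; exact: measurable_discount.
  by apply: measurable_funM => //; exact: measurable_indic.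
elim: n => [_|n IHn ac].
  by rewrite big_nil; apply: integral0_eq => t _; rewrite big_nil mulr0.
have ac' i : (i < n)%N -> 0 <= a i /\ 0 <= c i by move=> /leqW; exact: ac.
under eq_integral do rewrite big_nat_recr//= mulrDr EFinD.
rewrite big_nat_recr//= EFinD -IHn// ge0_integralD//.
- by have [? ?] := ac n (ltnSn n); rewrite integral_discount_step.
- move=> t _; rewrite lee_fin mulr_ge0//.
    by rewrite mulr_ge0 ?expR_ge0// ltW.
  rewrite big_nat_cond sumr_ge0// => i /andP[/andP[_ /ac'[? ?]] _].
  by rewrite mulr_ge0.
- apply/measurable_EFinP.
  apply: measurable_funM.
    by apply: measurable_funM => //; exact: measurable_discount.
  apply: measurable_sum => i.
  by apply: measurable_funM => //; exact: measurable_indic.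
- move=> t _; rewrite lee_fin !mulr_ge0 ?expR_ge0 ?(ltW alpha_gt0)//.
  by have [] := ac n (ltnSn n).
- by apply/measurable_EFinP; exact: mstep.
Qed.

(** This is what integration by parts gives for the integral of
    [p e^(- alpha t)] against [g] over [0, b]: after time [b] the stopped
    integrand is constant, and its tail is exactly the boundary term
    [e^(- alpha b) p g(b)]. *)
Definition stopped_integral (b : R) : \bar R :=
  (\int[mu]_(t in `[0%R, +oo[) (alpha * disc t * (p * g (Num.min t b)))%:E)%E.

Lemma indic_itvcy (c t : R) : \1_(`[c, +oo[) t = (if c <= t then 1 else 0) :> R.
Proof. by rewrite indicE mem_setE in_itv/= andbT; case: (_ <= _). Qed.

(** Over a cell [c, d] of a partition, the increment of the stopped function
    [g(min t .)] lies between two steps of height [g d - g c], located at [d]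
    and at [c]; the weighted integral of a step is explicit, so summing over
    the cells yields [stopped_integral_bounds]. *)
Lemma step_le_increment (c d t : R) : 0 <= c -> c <= d -> 0 <= t ->
  (g d - g c) * \1_(`[d, +oo[) t <= g (Num.min t d) - g (Num.min t c).
Proof.
move=> c0 cd t0; rewrite indic_itvcy; case: (leP d t) => [dt|td].
  by rewrite mulr1 (min_idPr (le_trans cd dt)).
rewrite mulr0 subr_ge0 g_nd ?le_min ?t0//.
by rewrite ge_min lexx.
Qed.

Lemma increment_le_step (c d t : R) : 0 <= c -> c <= d -> 0 <= t ->
  g (Num.min t d) - g (Num.min t c) <= (g d - g c) * \1_(`[c, +oo[) t.
Proof.
move=> c0 cd t0; rewrite indic_itvcy; case: (leP c t) => [ct|tc].
  rewrite mulr1 lerD2r g_nd//; first by rewrite le_min t0 (le_trans c0).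
  by rewrite ge_min lexx orbT.
by rewrite mulr0 (min_idPl (le_trans (ltW tc) cd)) subrr.
Qed.

Lemma ge0_from_start (t : R) : 0 <= t -> 0 <= g t.
Proof. by move=> t0; rewrite -g0 g_nd. Qed.

Lemma measurable_nondecreasing_ge0 (f : R -> R) :
  (forall s t, 0 <= s -> s <= t -> f s <= f t) ->
  measurable_fun (`[0%R, +oo[ : set R) f.
Proof.
move=> f_nd.
apply: (@eq_measurable_fun _ _ _ _ _ (fun t : R => f (Num.max 0 t))).
  by move=> t; rewrite inE/= in_itv/= andbT => /max_idPr ->.
apply: nondecreasing_measurable => // s t st.
apply: f_nd; first by rewrite le_max lexx.
by rewrite ge_max !le_max lexx st orbT.
Qed.

Lemma measurable_stopped_integral (b : R) : 0 <= b ->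
  measurable_fun (`[0%R, +oo[ : set R)
    (fun t => alpha * disc t * (p * g (Num.min t b))).
Proof.
move=> b0; apply: measurable_funM.
  by apply: measurable_funM => //; exact: measurable_discount.
apply: measurable_funM => //; apply: measurable_nondecreasing_ge0 => s t s0 st.
by rewrite g_nd// ?le_min ?s0// ge_min st/= ge_min lexx orbT.
Qed.

Section Partition.
Variables (b : R) (s : seq R).
Hypothesis b_ge0 : 0 <= b.
Hypothesis bs : itv_partition 0 b s.
Let c := nth b (0 :: s).

Lemma partition_step (i : nat) : (i < size s)%N -> 0 <= c i /\ c i < c i.+1.
Proof.
move=> si; split.
  by apply: (itv_partition_nth_ge _ bs); rewrite ltnS ltnW.
by case: bs => /(pathP b)/(_ _ si).
Qed.

Lemma partition_last : c (size s) = b.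
Proof. by case: bs => _ /eqP <-; rewrite /c nth_last. Qed.

Lemma stopped_integral_bounds :
  ((\sum_(0 <= i < size s) p * (g (c i.+1) - g (c i)) * disc (c i.+1))%:E <=
     stopped_integral b <=
   (\sum_(0 <= i < size s) p * (g (c i.+1) - g (c i)) * disc (c i))%:E)%E.
Proof.
have ci i : (i < size s)%N -> 0 <= c i by move=> /partition_step[].
have ciS i : (i < size s)%N -> c i <= c i.+1 by move=> /partition_step[_ /ltW].
have jump i : (i < size s)%N -> 0 <= p * (g (c i.+1) - g (c i)).
  by move=> si; rewrite mulr_ge0// subr_ge0 g_nd ?ci ?ciS.
have telescope t : 0 <= t -> p * g (Num.min t b) = \sum_(0 <= i < size s)
    p * (g (Num.min t (c i.+1)) - g (Num.min t (c i))).
  move=> t0; rewrite -mulr_sumr (telescope_sumr (fun i => g (Num.min t (c i))))//.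
  by rewrite partition_last /c/= (min_idPr t0) g0 subr0.
have msteps (e : nat -> R) : measurable_fun (`[0%R, +oo[ : set R)
    (fun t => alpha * disc t * \sum_(0 <= i < size s)
       p * (g (c i.+1) - g (c i)) * \1_(`[e i, +oo[) t).
  apply: measurable_funM.
    by apply: measurable_funM => //; exact: measurable_discount.
  apply: measurable_sum => i.
  by apply: measurable_funM => //; exact: measurable_indic.
have k0 t : 0 <= alpha * disc t by rewrite mulr_ge0 ?expR_ge0// ltW.
apply/andP; split.
- rewrite -(@integral_discount_steps _ _ (fun i => c i.+1)); last first.
    by move=> i si; split; [exact: jump|exact: le_trans (ci _ si) (ciS _ si)].
  apply: ge0_le_integral => //.
  + move=> t _; rewrite lee_fin mulr_ge0// big_nat_cond sumr_ge0//.
    by move=> i /andP[/andP[_ si] _]; rewrite mulr_ge0// jump.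
  + by apply/measurable_EFinP; exact: msteps.
  + by apply/measurable_EFinP; exact: measurable_stopped_integral.
  move=> t /=; rewrite in_itv/= andbT => t0; rewrite lee_fin ler_wpM2l//.
  rewrite telescope//.
  apply: ler_sum_nat => i /andP[_ si].
  rewrite -mulrA ler_wpM2l//.
  by apply: step_le_increment => //; [exact: ci|exact: ciS].
- rewrite -(@integral_discount_steps _ _ c); last first.
    by move=> i si; split; [exact: jump|exact: ci].
  apply: ge0_le_integral => //.
  + move=> t; rewrite /= in_itv/= andbT => t0.
    by rewrite lee_fin mulr_ge0 ?k0// mulr_ge0// ge0_from_start// le_min t0.
  + by apply/measurable_EFinP; exact: measurable_stopped_integral.
  + by apply/measurable_EFinP; exact: msteps.
  move=> t /=; rewrite in_itv/= andbT => t0; rewrite lee_fin ler_wpM2l//.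
  rewrite telescope//.
  apply: ler_sum_nat => i /andP[_ si].
  rewrite -mulrA ler_wpM2l//.
  by apply: increment_le_step => //; [exact: ci|exact: ciS].
Qed.

End Partition.

Lemma discount_lipschitz (c d : R) : 0 <= c -> c <= d ->
  disc c - disc d <= alpha * (d - c).
Proof.
move=> c0 cd; have -> : disc d = disc c * expR (- (alpha * (d - c))).
  by rewrite -expRD; congr expR; ring.
have e1 : disc c <= 1.
  by rewrite -expR0 ler_expR oppr_le0 mulr_ge0// ltW.
have := expR_ge1Dx (- (alpha * (d - c))).
have := expR_ge0 (- (alpha * c)).
have : 0 <= alpha * (d - c) by rewrite mulr_ge0 ?subr_ge0// ltW.
move: (alpha * (d - c)) => z; nra.
Qed.

Lemma stopped_integral_fin_num (b : R) : 0 <= b -> stopped_integral b \is a fin_num.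
Proof.
move=> b0; have [<-|] := eqVneq 0 b.
  rewrite /stopped_integral integral0_eq// => t /=; rewrite in_itv/= andbT => t0.
  by rewrite (min_idPr t0) g0 !mulr0.
move=> bN0; have {}b0 : 0 < b by rewrite lt_neqAle bN0.
have := stopped_integral_bounds (ltW b0) (itv_partition1 b0).
move=> /andP[lo hi]; rewrite fin_numElt (lt_le_trans _ lo) ?ltNyr//.
by rewrite (le_lt_trans hi) ?ltry.
Qed.

(** The Riemann-Stieltjes sum and [stopped_integral b] lie between the same two
    sums, where the decreasing weight is evaluated at the two ends of each
    cell.  The gap between these is at most the mesh times
    [alpha p (g b - g 0)]. *)
Lemma is_RS_integral_discount (b : R) : 0 <= b ->
  is_RS_integral (fun t => disc t * p) g 0 b (fine (stopped_integral b)).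
Proof.
move=> b0 eps eps0.
have gb0 := ge0_from_start b0.
have apg0 : 0 <= alpha * p * g b by rewrite !mulr_ge0// ltW.
have D0 : 0 < alpha * p * g b + 1 by lra.
(* The summand 1 only keeps the denominator positive. *)
exists (eps / (alpha * p * g b + 1)); first exact: divr_gt0.
set delta := eps / _ => s tag bs mesh.
have := stopped_integral_bounds b0 bs.
rewrite -{1 2}(fineK (stopped_integral_fin_num b0)) !lee_fin.
move: (fine _) => I /andP[lo hi].
set c := nth b (0 :: s).
have ci i : (i < size s)%N -> 0 <= c i by move=> /(partition_step bs)[].
have ciS i : (i < size s)%N -> c i <= c i.+1 by move=> /(partition_step bs)[_ /ltW].
have jump i : (i < size s)%N -> 0 <= p * (g (c i.+1) - g (c i)).
  by move=> si; rewrite mulr_ge0// subr_ge0 g_nd ?ci ?ciS.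
have disc_anti u v : u <= v -> disc v <= disc u.
  by move=> uv; rewrite ler_expR lerN2 ler_wpM2l// ltW.
have RSE : RS_sum (fun t => disc t * p) g 0 b s tag =
    \sum_(0 <= i < size s) p * (g (c i.+1) - g (c i)) * disc (tag i).
  by apply: eq_bigr => i _; rewrite -/c; ring.
have lo' : \sum_(0 <= i < size s) p * (g (c i.+1) - g (c i)) * disc (c i.+1) <=
    RS_sum (fun t => disc t * p) g 0 b s tag.
  rewrite RSE.
  apply: ler_sum_nat => i /andP[_ si]; rewrite ler_wpM2l ?jump//.
  by apply: disc_anti; have [_ /andP[]] := mesh i si.
have hi' : RS_sum (fun t => disc t * p) g 0 b s tag <=
    \sum_(0 <= i < size s) p * (g (c i.+1) - g (c i)) * disc (c i).
  rewrite RSE.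
  apply: ler_sum_nat => i /andP[_ si]; rewrite ler_wpM2l ?jump//.
  by apply: disc_anti; have [_ /andP[]] := mesh i si.
have gap : \sum_(0 <= i < size s) p * (g (c i.+1) - g (c i)) * disc (c i) -
    \sum_(0 <= i < size s) p * (g (c i.+1) - g (c i)) * disc (c i.+1) <=
    alpha * p * g b * delta.
  rewrite -sumrB.
  apply: (@le_trans _ _ (\sum_(0 <= i < size s)
      (alpha * delta * p) * (g (c i.+1) - g (c i)))).
    apply: ler_sum_nat => i /andP[_ si]; rewrite -mulrBr.
    rewrite -mulrA [leRHS]mulrC ler_wpM2l ?jump//.
    apply: le_trans (discount_lipschitz (ci _ si) (ciS _ si)) _.
    by rewrite ler_wpM2l ?(ltW alpha_gt0)//; have [/ltW] := mesh i si.
  rewrite -mulr_sumr (telescope_sumr (fun i => g (c i)))//.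
  by rewrite {1}/c (partition_last bs) {1}/c/= g0 subr0; lra.
have small : alpha * p * g b * delta < eps.
  rewrite /delta mulrA ltr_pdivrMr//.
  by rewrite mulrC mulrDr mulr1; lra.
rewrite ltr_norml; apply/andP; split; lra.
Qed.

End RiemannStieltjes.

Section RiemannStieltjesUniqueness.
Context (R : realType).

Lemma fine_itv_partition (a b delta : R) : a < b -> 0 < delta ->
  exists2 s : seq R, itv_partition a b s &
    forall i, (i < size s)%N ->
      nth b (a :: s) i.+1 - nth b (a :: s) i < delta /\
      nth b (a :: s) i <= nth b (a :: s) i <= nth b (a :: s) i.+1.
Proof.
move=> ab delta0; pose n := (Num.truncn ((b - a) / delta)).+1.
have n0 : 0 < n%:R :> R by rewrite ltr0n.
have step : (b - a) / n%:R < delta.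
  by rewrite ltr_pdivrMr// mulrC -ltr_pdivrMr//; exact: truncnS_gt.
have step0 : 0 < (b - a) / n%:R by rewrite divr_gt0// subr_gt0.
pose s := mkseq (fun i => a + (b - a) / n%:R * i.+1%:R) n.
have nthE i : (i <= n)%N -> nth b (a :: s) i = a + (b - a) / n%:R * i%:R.
  by case: i => [|i] ni /=; [rewrite mulr0 addr0|rewrite nth_mkseq].
have stepE i : (i < n)%N ->
    nth b (a :: s) i.+1 - nth b (a :: s) i = (b - a) / n%:R.
  by move=> ni; rewrite !nthE ?(ltnW ni)// -(natr1 i); ring.
have ss : size s = n by rewrite size_mkseq.
exists s.
  split.
    apply/(pathP b) => i; rewrite ss => ni.
    by rewrite -subr_gt0 -[nth b s i]/(nth b (a :: s) i.+1) stepE.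
  have -> : last a s = nth b (a :: s) n by rewrite -ss (nth_last b (a :: s)).
  by rewrite nthE// divfK ?lt0r_neq0//; apply/eqP; ring.
by move=> i; rewrite ss => ni; rewrite stepE// lexx -subr_ge0 stepE// ltW.
Qed.

(** The total operator [RS_integral] picks some value of the integral, so
    computing it requires that there be only one. *)
Lemma is_RS_integral_unique (f g : R -> R) (a b I J : R) : a < b ->
  is_RS_integral f g a b I -> is_RS_integral f g a b J -> I = J.
Proof.
move=> ab fI fJ; apply/eqP; rewrite -subr_eq0 -normr_le0.
apply/ler_addgt0Pr => e e0; rewrite add0r.
have e20 : 0 < e / 2 by rewrite divr_gt0.
have [d1 d10 H1] := fI _ e20; have [d2 d20 H2] := fJ _ e20.
have d0 : 0 < Num.min d1 d2 by rewrite lt_min d10.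
have [s abs mesh] := fine_itv_partition ab d0.
have {}H1 := H1 s (fun i => nth b (a :: s) i) abs.
have {}H2 := H2 s (fun i => nth b (a :: s) i) abs.
have : `|RS_sum f g a b s (fun i => nth b (a :: s) i) - I| < e / 2.
  by apply: H1 => i /mesh[]; rewrite lt_min => /andP[-> _] ->.
have : `|RS_sum f g a b s (fun i => nth b (a :: s) i) - J| < e / 2.
  by apply: H2 => i /mesh[]; rewrite lt_min => /andP[_ ->] ->.
move: (RS_sum _ _ _ _ _ _) => S; rewrite !ltr_norml ler_norml.
move=> /andP[? ?] /andP[? ?]; apply/andP; split; lra.
Qed.

Lemma RS_integralE (f g : R -> R) (a b I : R) : a < b ->
  is_RS_integral f g a b I -> RS_integral f g a b = I.
Proof.
move=> ab fI; apply: xget_subset1 => // x y fx fy.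
exact: is_RS_integral_unique fx fy.
Qed.

End RiemannStieltjesUniqueness.

Section DiscountedRiemannStieltjes.
Context (R : realType) (alpha p : R) (g : R -> R).
Hypothesis alpha_gt0 : 0 < alpha.
Hypothesis p_ge0 : 0 <= p.
Hypothesis g_nd : forall s t, 0 <= s -> s <= t -> g s <= g t.
Hypothesis g0 : g 0 = 0.
Notation mu := (@lebesgue_measure R).
Notation disc := (fun t : R => expR (- (alpha * t))).

(** The stopped integrand increases with [b], so the limit along the reals is
    that along the integers, which monotone convergence computes. *)
Lemma stopped_integral_cvg :
  stopped_integral alpha p g b @[b --> +oo] -->
  (\int[mu]_(t in `[0%R, +oo[) (alpha * disc t * (p * g t))%:E)%E.
Proof.
pose F (b : R) := stopped_integral alpha p g (Num.max 0 b).
have k0 t : 0 <= alpha * disc t by rewrite mulr_ge0 ?expR_ge0// ltW.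
have g_ge0 := ge0_from_start g_nd g0.
have msc := measurable_stopped_integral alpha p g_nd.
have int_ge0 b t : 0 <= b -> `[0, +oo[%classic t ->
    (0 <= (alpha * disc t * (p * g (Num.min t b)))%:E)%E.
  rewrite /= in_itv/= andbT => b0 t0; rewrite lee_fin mulr_ge0// mulr_ge0//.
  by rewrite g_ge0// le_min t0.
have int_nd b b' t : 0 <= b -> b <= b' -> `[0, +oo[%classic t ->
    ((alpha * disc t * (p * g (Num.min t b)))%:E <=
     (alpha * disc t * (p * g (Num.min t b')))%:E)%E.
  rewrite /= in_itv/= andbT => b0 bb' t0; rewrite lee_fin ler_wpM2l// ler_wpM2l//.
  by rewrite g_nd ?le_min ?t0// ge_min lexx/= ge_min bb' orbT.
have max0 (b : R) : 0 <= Num.max 0 b by rewrite le_max lexx.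
have ndF : {homo F : a b / a <= b >-> (a <= b)%E}.
  move=> a b ab; apply: ge0_le_integral => //.
  - by move=> t; apply: int_ge0.
  - by apply/measurable_EFinP; exact: msc.
  - by apply/measurable_EFinP; exact: msc.
  - by move=> t; apply: int_nd => //; rewrite ge_max !le_max lexx ab orbT.
have FF := nondecreasing_cvge ndF.
suff supE : ereal_sup (range F) =
    (\int[mu]_(t in `[0%R, +oo[) (alpha * disc t * (p * g t))%:E)%E.
  rewrite -supE; apply: cvg_trans FF; apply: near_eq_cvg; near=> b.
  by rewrite /F (max_idPr _)//; near: b; exact: nbhs_pinfty_ge.
have FN : F n%:R @[n --> \oo] --> ereal_sup (range F).
  by apply: cvg_comp FF; exact: cvgr_idn.
have : F n%:R @[n --> \oo] -->
    (\int[mu]_(t in `[0%R, +oo[)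
       limn (fun n : nat => (alpha * disc t * (p * g (Num.min t n%:R)))%:E))%E.
  under eq_fun do rewrite /F (max_idPr _)//.
  apply: cvg_monotone_convergence => //.
  - by move=> n; apply/measurable_EFinP; exact: msc.
  - by move=> n t; apply: int_ge0.
  - by move=> t t0 m n mn; apply: int_nd => //; rewrite ler_nat.
move=> /(cvg_unique _ FN) -> //.
apply: eq_integral => t _; apply: lim_near_cst => //.
near=> n; rewrite (min_idPl _)//; near: n; exact: nbhs_infty_ger.
Unshelve. all: by end_near. Qed.

(** Integration by parts on the half-line, in [0, +oo]: for [b > 0] the integral
    over [0, b] is [stopped_integral b]. *)
Lemma RS_integral_infty_discount :
  RS_integral_infty (fun t => disc t * p) g 0 =
  (\int[mu]_(t in `[0%R, +oo[) (alpha * disc t * (p * g t))%:E)%E.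
Proof.
apply: cvg_lim => //; apply: cvg_trans stopped_integral_cvg.
apply: near_eq_cvg; near=> b.
have b0 : 0 < b by near: b; exact: nbhs_pinfty_gt.
rewrite (RS_integralE b0 (is_RS_integral_discount _ _ _ _ (ltW b0)))//.
by rewrite fineK//; apply: stopped_integral_fin_num => //; exact: ltW.
Unshelve. all: by end_near. Qed.

End DiscountedRiemannStieltjes.

(** * Joint measurability *)

Lemma continuous_extend_left (R : realType) (f : R -> R) :
  {within `[0, +oo[, continuous f} -> continuous (fun t : R => f (Num.max 0 t)).
Proof.
move=> /subspace_continuousP cf t.
have m0 (s : R) : `[0, +oo[%classic (Num.max 0 s).
  by rewrite /= in_itv/= andbT le_max lexx.
apply: (@cvg_comp _ _ _ (fun s : R => Num.max 0 s) f _ _ _ _ (cf _ (m0 t))) => A /= wA.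
have cmax : continuous (fun s : R => Num.max 0 s).
  by move=> s; apply: (@continuous_max _ _ (cst 0) id); [exact: cvg_cst|exact: cvg_id].
have H : \near t, `[0, +oo[%classic (Num.max 0 t) -> A (Num.max 0 t) := cmax t _ wA.
by near=> s; have /= := near H s; apply => //; exact: m0.
Unshelve. all: by end_near.
Qed.

(** The process sampled at the last multiple of [1 / (n + 1)] up to [t] takes,
    on each of countably many time intervals, the value of one marginal; path
    continuity makes these approximations converge. *)
Lemma measurable_continuous_process d (T : measurableType d) (R : realType)
    (X : R -> T -> R) :
  (forall t, 0 <= t -> measurable_fun setT (X t)) ->
  (forall om, {within `[0, +oo[, continuous (X ^~ om)}) ->
  measurable_fun setT (fun z : T * R => X (Num.max 0 z.2) z.1).
Proof.
move=> mX cX; pose k n (t : R) := Num.truncn (t * n.+1%:R).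
apply: (@measurable_fun_cvg _ _ _ _
  (fun n (z : T * R) => X ((k n z.2)%:R / n.+1%:R) z.1)).
  move=> n _ A mA; rewrite setTI.
  rewrite [X in measurable X](_ : _ = \bigcup_j
      ((X (j%:R / n.+1%:R) @^-1` A) `*` [set t | k n t = j])); last first.
    apply/seteqP; split => [z /= Az|z [j _ [/= Az jz]]]; first by exists (k n z.2).
    by rewrite /= jz.
  apply: bigcup_measurable => j _; apply: measurableX.
    by rewrite -[X in measurable X]setTI; apply: mX => //; rewrite divr_ge0.
  rewrite [X in measurable X](_ : _ =
      setT `&` (fun t : R => (k n t)%:R) @^-1` [set j%:R : R]); last first.
    rewrite setTI; apply/seteqP; split => t /= => [->//|/eqP].
    by rewrite eqr_nat => /eqP.
  suff : measurable_fun setT (fun t : R => (k n t)%:R : R) by apply.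
  apply: nondecreasing_measurable => // s t st.
  rewrite ler_nat truncn_le_nat (@le_lt_trans _ _ (t * n.+1%:R))//.
    by rewrite ler_wpM2r.
  exact: truncnS_gt.
move=> [om t] _ /=.
have kmax n : X ((k n t)%:R / n.+1%:R) om =
    X (Num.max 0 ((k n t)%:R / n.+1%:R)) om.
  by rewrite (max_idPr _)// divr_ge0.
suff kt : (k n t)%:R / n.+1%:R @[n --> \oo] --> Num.max 0 t.
  rewrite (funext kmax) -[in X in _ --> X](max_idPr (_ : 0 <= Num.max 0 t)).
    exact: (cvg_comp _ _ kt (continuous_extend_left (cX om) (x := Num.max 0 t))).
  by rewrite le_max lexx.
apply/cvgrPdist_le => e e0; near=> n.
have n0 : 0 < n.+1%:R :> R by [].
apply: (@le_trans _ _ (n.+1%:R^-1)); last first.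
  near: n; have /cvgrPdist_le/(_ e e0) := @cvg_harmonic R.
  by apply: filterS => n /=; rewrite sub0r normrN ger0_norm ?invr_ge0.
have [t0|t0] := leP 0 t.
  have := truncn_itv (mulr_ge0 t0 (ltW n0)).
  rewrite -/(k n t) -ler_pdivrMr// -ltr_pdivlMr// -(natr1 (k n t)) mulrDl mul1r.
  move=> /andP[k1 k2]; by rewrite ger0_norm ?subr_ge0// lerBlDl ltW.
have -> : k n t = 0%N.
  by apply/eqP; rewrite -leqn0 truncn_le_nat (@lt_trans _ _ 0)// pmulr_llt0.
by rewrite mul0r subr0 normr0 invr_ge0.
Unshelve. all: by end_near. Qed.

Section MeasurableRegulator.
Context d (T : measurableType d) (R : realType) (W : R -> T -> R) (x u : R).
Hypothesis mW : forall t, 0 <= t -> measurable_fun setT (W t).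
Hypothesis cW : forall om, {within `[0, +oo[, continuous (W ^~ om)}.

Let clamp (q : R) := Num.max 0 (Num.min 1 q).

(** Rational fractions [q] of the time [t] suffice in the supremum defining the
    regulator.  Parametrizing the times in [0, t] by [q t], with [q] clamped to
    [0, 1], makes the index set independent of [t], so that the regulator is
    measurable jointly in the sample and the time. *)
Lemma regulator_gtP om (t c : R) : 0 <= t -> 0 <= c ->
  c < regulator (W ^~ om) x u t <->
  exists q : rat, c < u * (clamp (ratr q) * t) - x - W (clamp (ratr q) * t) om.
Proof.
move=> t0 c0.
have clamp_itv q : 0 <= clamp q <= 1.
  by rewrite /clamp le_max lexx/= ge_max ler01 ge_min lexx.
split=> [cL|[q cq]]; last first.
  apply: lt_le_trans cq _; apply: le_regulator_path => //.
  by have /andP[? ?] := clamp_itv (ratr q); rewrite mulr_ge0//= ler_piMl.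
have [s /andP[s0 st] cs] : exists2 s, 0 <= s <= t & c < u * s - x - W s om.
  apply: contrapT => nex; move: cL; rewrite ltNge => /negP; apply.
  apply/regulator_leP => //; split=> // s st; rewrite leNgt; apply/negP => cs.
  by apply: nex; exists s.
pose f q := u * (clamp q * t) - x - W (Num.max 0 (clamp q * t)) om.
have cclamp : continuous clamp.
  move=> q; apply: (@continuous_max _ _ (cst 0) _); first exact: cvg_cst.
  by apply: (@continuous_min _ _ (cst 1) id); [exact: cvg_cst|exact: cvg_id].
have cf : continuous f.
  move=> q; have ct : {for q, continuous (fun q => clamp q * t)}.
    by apply: cvgM; [exact: cclamp|exact: cvg_cst].
  apply: cvgB.
    by apply: cvgB; [apply: cvgM => //; exact: cvg_cst|exact: cvg_cst].
  exact: (cvg_comp _ _ ct (continuous_extend_left (cW (om := om)) (x := _))).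
have sE : clamp (s / t) * t = s.
  rewrite /clamp (min_idPr _); last first.
    have [<-|t_neq0] := eqVneq 0 t; first by rewrite invr0 mulr0.
    by rewrite ler_pdivrMr ?mul1r// lt_neqAle t_neq0.
  rewrite (max_idPr _) ?divr_ge0//.
  have [t0'|t_neq0] := eqVneq 0 t; last by rewrite divfK// eq_sym.
  by apply/eqP; rewrite -t0' mulr0 eq_le s0 t0' st.
have [q] : exists q, f (ratr q) > c.
  have oS : open (f @^-1` [set y | c < y]).
    by apply: open_comp => [z _|]; [exact: cf|exact: open_gt].
  have [|z [fz [q _ qz]]] := @dense_rat R _ _ oS; last by exists q; rewrite qz.
  by exists (s / t); rewrite /= /f sE (max_idPr s0).
rewrite /f (max_idPr _); first by exists q.
by rewrite mulr_ge0// (andP (clamp_itv _)).1.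
Qed.

Lemma measurable_regulator :
  measurable_fun setT
    (fun z : T * R => regulator (W ^~ z.1) x u (Num.max 0 z.2)).
Proof.
apply: (measurability _ (RGenOInfty.measurableE R)) => //.
move=> _ [_ [c ->] <-].
have m0 (t : R) : 0 <= Num.max 0 t by rewrite le_max lexx.
have qm0 (q t : R) : 0 <= clamp q * Num.max 0 t.
  by rewrite mulr_ge0// /clamp le_max lexx.
have [c0|c0] := ltP c 0.
  rewrite [X in measurable X](_ : _ = setT)//.
  apply/seteqP; split=> // z _; split=> //=; rewrite in_itv/= andbT.
  by apply: lt_le_trans c0 _; apply: regulator_ge0.
rewrite [X in measurable X](_ : _ = \bigcup_(q : rat)
    (setT `&` (fun z : T * R => u * (clamp (ratr q) * Num.max 0 z.2) - x -
        W (Num.max 0 (clamp (ratr q) * Num.max 0 z.2)) z.1) @^-1` `]c, +oo[)); last first.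
  apply/seteqP; split=> [z [_] /=|z [q _] [_] /=]; rewrite !in_itv/= !andbT.
    by move=> /regulator_gtP-/(_ (m0 _) c0)[q cq]; exists q => //; split => //=;
      rewrite in_itv/= andbT (max_idPr (qm0 _ _)).
  move=> cq; split=> //; apply/regulator_gtP => //.
  by exists q; move: cq; rewrite (max_idPr (qm0 _ _)).
apply: countable_bigcupT_measurable; first exact: countableP.
move=> q; have mq : measurable_fun setT (fun z : T * R => clamp (ratr q) * Num.max 0 z.2).
  apply: measurable_funM => //; apply: measurable_maxr => //.
suff : measurable_fun setT (fun z : T * R => u * (clamp (ratr q) * Num.max 0 z.2) - x -
        W (Num.max 0 (clamp (ratr q) * Num.max 0 z.2)) z.1) by apply.
apply: measurable_funB.
  by apply: measurable_funB => //; apply: measurable_funM.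
apply: (measurableT_comp (measurable_continuous_process mW cW)
  (_ : measurable_fun setT (fun z : T * R =>
    (z.1, clamp (ratr q) * Num.max 0 z.2)))).
exact: measurable_fun_pair.
Qed.

End MeasurableRegulator.

(** * Minimization of coercive functions *)

Lemma limn_einf_le_bound (R : realType) (u : (\bar R)^nat) (c : \bar R) :
  (forall n, u n <= c)%E -> (limn_einf u <= c)%E.
Proof.
move=> uc; apply: le_trans (limn_einf_sup u) _.
rewrite /limn_esup /limf_esup; apply: ge_ereal_inf.
exists (ereal_sup (u @` setT)); first by exists setT => //; exact: filterT.
by apply: ge_ereal_sup => _ [n _ <-]; exact: uc.
Qed.

(** The direct method: a minimizing sequence is bounded by coercivity, it has a
    convergent subsequence, and the limit stays in each sublevel set above the
    infimum. *)
Lemma closed_sublevel_coercive_attains_inf (R : realType) (F : R -> \bar R)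
    (k : R -> R) :
  (forall u, 0 <= u -> (0 <= F u)%E) ->
  (forall u, 0 <= u -> ((k u)%:E <= F u)%E) ->
  k u @[u --> +oo] --> +oo ->
  (forall (v : nat -> R) (u : R) (c : \bar R), (forall n, 0 <= v n) ->
     v n @[n --> \oo] --> u -> (forall n, F (v n) <= c)%E -> (F u <= c)%E) ->
  exists2 u, 0 <= u & F u = ereal_inf [set F u | u in [set u : R | 0 <= u]].
Proof.
move=> F0 kF k_infty F_lsc; set S := [set F u | u in _].
have inf_le u : 0 <= u -> (ereal_inf S <= F u)%E.
  by move=> u0; apply: ereal_inf_lbound; exists u.
have inf0 : (0 <= ereal_inf S)%E by apply: le_ereal_inf_tmp => _ [u u0 <-]; exact: F0.
have [Soo|Sfin] := eqVneq (ereal_inf S) +oo%E.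
  by exists 0 => //; apply/eqP; rewrite eq_le inf_le// Soo leey.
have {}Sfin : ereal_inf S \is a fin_num.
  by rewrite ge0_fin_numE// ltey.
have /choice[v vP] (n : nat) : exists u, 0 <= u /\ (F u < ereal_inf S + (n.+1%:R^-1)%:E)%E.
  have [|_ [u u0 <-] uS] := @lb_ereal_inf_adherent _ S (n.+1%:R^-1) _ Sfin.
    by rewrite invr_gt0.
  by exists u.
have [M [_ kM]] : \forall u \near +oo, fine (ereal_inf S) + 1 <= k u.
  by move/cvgryPge : k_infty; apply.
have [u [uM]] : (`[0, Num.max 0 M] `&` cluster (v n @[n --> \oo])) !=set0.
  apply: segment_compact; exists 0%N => // n _ /=.
  rewrite in_itv/= (vP n).1/= le_max; apply/orP; right; rewrite leNgt; apply/negP => Mv.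
  have := kM _ Mv; apply/negP; rewrite -ltNge -lte_fin.
  apply: le_lt_trans (kF _ (vP n).1) _; apply: lt_le_trans (vP n).2 _.
  rewrite EFinD fineK// leeD2l// lee_fin invf_le1//; last by rewrite ler1n.
move=> /cluster_eventually_cvg[f f_incr vfu].
have u0 : 0 <= u by move: uM; rewrite /= in_itv/= => /andP[].
exists u => //; apply/eqP; rewrite eq_le inf_le// andbT.
apply/lee_addgt0Pr => e e0.
have [N _ NP] : \forall n \near \oo, n.+1%:R^-1 <= e.
  have /cvgrPdist_le/(_ e e0) := @cvg_harmonic R.
  by apply: filterS => n /=; rewrite sub0r normrN ger0_norm ?invr_ge0.
have f_ge n : (n <= f n)%N.
  by elim: n => // n IHn; apply: leq_ltn_trans IHn _; rewrite (leqW_mono f_incr).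
apply: (F_lsc (fun n => v (f (n + N)%N))) => [n||n].
- exact: (vP _).1.
- by rewrite (@cvg_shiftn N _ (v \o f)).
- apply: le_trans (ltW (vP _).2) _; rewrite leeD2l// lee_fin.
  apply: NP => /=; apply: leq_trans (f_ge _); exact: leq_addl.
Qed.

(** * The discounted cost as a function of the drift *)

Section DiscountedCost.
Context (R : realType) d (T : measurableType d) (P : probability T R).
Variables (W : R -> {RV P >-> R}) (h C : R -> R) (p alpha x : R).
Hypothesis W_continuous : forall om, {within `[0, +oo[, continuous (fun t => W t om)}.
Hypothesis W_start : forall om, W 0 om = 0.
Hypothesis p_ge0 : 0 <= p.
Hypothesis h_ge0 : forall u, 0 <= u -> 0 <= h u.
Hypothesis h_continuous : {within `[0, +oo[, continuous h}.
Hypothesis h_nondecreasing : {in `[0, +oo[ &, {homo h : u v / u <= v}}.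
Hypothesis C_ge0 : forall y, 0 <= y -> 0 <= C y.
Hypothesis C_continuous : {within `[0, +oo[, continuous C}.
Hypothesis C_nondecreasing : {in `[0, +oo[ &, {homo C : y z / y <= z}}.
Hypothesis alpha_gt0 : 0 < alpha.
Hypothesis x_ge0 : 0 <= x.
Notation mu := (@lebesgue_measure R).
Notation path om := (fun s => W s om).

(** The control cost enters through its integrated-by-parts form.  Times are
    truncated at zero so that the density makes sense, and is measurable, on
    the whole product space. *)
Definition cost_density (u : R) (z : T * R) : R :=
  let t := Num.max 0 z.2 in
  expR (- (alpha * t)) * (h u + C (reflected (path z.1) x u t)) +
  alpha * expR (- (alpha * t)) * (p * regulator (path z.1) x u t).

Definition path_cost (u : R) (om : T) : \bar R :=
  (\int[mu]_(t in `[0%R, +oo[) (cost_density u (om, t))%:E)%E.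

Lemma cost_densityE (u : R) (om : T) (t : R) : 0 <= t ->
  cost_density u (om, t) =
  expR (- (alpha * t)) * (h u + C (reflected (path om) x u t)) +
  alpha * expR (- (alpha * t)) * (p * regulator (path om) x u t).
Proof. by move=> t0; rewrite /cost_density /= (max_idPr t0). Qed.

Lemma cost_density_ge0 (u : R) (z : T * R) : 0 <= u -> 0 <= cost_density u z.
Proof.
move=> u0; rewrite /cost_density; set t := Num.max _ _.
have t0 : 0 <= t by rewrite /t le_max lexx.
rewrite addr_ge0//.
  by rewrite mulr_ge0 ?expR_ge0// addr_ge0 ?h_ge0 ?C_ge0 ?reflected_ge0.
by rewrite !mulr_ge0 ?expR_ge0 ?regulator_ge0// ltW.
Qed.

Lemma measurable_C_reflected (u : R) : measurable_fun setT
  (fun z : T * R => C (reflected (path z.1) x u (Num.max 0 z.2))).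
Proof.
have m0 (t : R) : 0 <= Num.max 0 t by rewrite le_max lexx.
have -> : (fun z : T * R => C (reflected (path z.1) x u (Num.max 0 z.2))) =
    (fun y => C (Num.max 0 y)) \o
    (fun z : T * R => reflected (path z.1) x u (Num.max 0 z.2)).
  by apply/funext => z /=; rewrite (max_idPr (reflected_ge0 _ _ _ _)).
apply: measurableT_comp.
  exact: continuous_measurable_fun (continuous_extend_left C_continuous).
have mmax : measurable_fun setT (fun z : T * R => Num.max 0 z.2) by exact: measurable_maxr.
apply: measurable_funD; last first.
  exact: (@measurable_regulator _ _ _ (fun t => W t : T -> R)).
apply: measurable_funD; last exact: (@measurable_continuous_process _ _ _ (fun t => W t : T -> R)).
by apply: measurable_funB => //; exact: measurable_funM.
Qed.

Lemma measurable_cost_density (u : R) : measurable_fun setT (cost_density u).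
Proof.
have mmax : measurable_fun setT (fun z : T * R => Num.max 0 z.2) by exact: measurable_maxr.
have mdisc : measurable_fun setT (fun z : T * R => expR (- (alpha * Num.max 0 z.2))).
  apply: (measurableT_comp (f := fun t : R => expR (- (alpha * t)))) => //.
  exact: measurable_discount.
apply: measurable_funD; apply: measurable_funM => //.
- by apply: measurable_funD => //; exact: measurable_C_reflected.
- exact: measurable_funM.
- apply: measurable_funM => //; exact: (@measurable_regulator _ _ _ (fun t => W t : T -> R)).
Qed.

Lemma measurable_cost_density_path (u : R) (om : T) (D : set R) :
  measurable_fun D (fun t => cost_density u (om, t)).
Proof.
apply: measurable_funTS.
exact: (measurable_fun_pair2 om (measurable_cost_density u)).
Qed.

Lemma path_cost_ge0 (u : R) (om : T) : 0 <= u -> (0 <= path_cost u om)%E.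
Proof. by move=> u0; apply: integral_ge0 => t _; rewrite lee_fin cost_density_ge0. Qed.

Lemma measurable_path_cost (u : R) : 0 <= u -> measurable_fun setT (path_cost u).
Proof.
move=> u0; pose f (z : T * R) := (cost_density u z * \1_(`[0, +oo[) z.2)%:E.
have -> : path_cost u = fubini_F mu f.
  apply/funext => om; rewrite /path_cost integral_mkcond /fubini_F.
  apply: eq_integral => t _; rewrite /f patchE indicE /=.
  by case: ifPn => _; rewrite ?mulr1 ?mulr0.
apply: measurable_fun_fubini_tonelli_F.
  apply/measurable_EFinP; apply: measurable_funM; first exact: measurable_cost_density.
  by apply: measurableT_comp => //; exact: measurable_indic.
by move=> z; rewrite lee_fin mulr_ge0 ?cost_density_ge0.
Qed.

Lemma discounted_costE (u : R) : 0 <= u ->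
  discounted_cost W h C p alpha x u = (\int[P]_om path_cost u om)%E.
Proof.
move=> u0; apply: eq_integral => om _.
have cw : {within `[0, +oo[, continuous (path om)} by exact: W_continuous.
rewrite RS_integral_infty_discount//; last 2 first.
- by move=> s t; exact: regulator_nondecreasing.
- exact: regulator_start.
have k0 t : 0 <= alpha * expR (- (alpha * t)) by rewrite mulr_ge0 ?expR_ge0// ltW.
have itv0 (t : R) : `[0, +oo[%classic t -> 0 <= t by rewrite /= in_itv/= andbT.
apply/esym; transitivity (\int[mu]_(t in `[0%R, +oo[)
  ((expR (- (alpha * t)) * (h u + C (reflected (path om) x u t)))%:E +
   (alpha * expR (- (alpha * t)) * (p * regulator (path om) x u t))%:E))%E.
  by apply: eq_integral => t; rewrite inE => /itv0 t0; rewrite cost_densityE// EFinD.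
apply: ge0_integralD => //.
- move=> t /itv0 t0; rewrite lee_fin mulr_ge0 ?expR_ge0//.
  by rewrite addr_ge0 ?h_ge0 ?C_ge0 ?reflected_ge0.
- apply/measurable_EFinP; apply: measurable_funM.
    exact: measurable_discount.
  apply: measurable_funD => //.
  apply: (@eq_measurable_fun _ _ _ _ _
    (fun t : R => C (reflected (path om) x u (Num.max 0 t)))).
    by move=> t; rewrite inE => /itv0 t0; rewrite (max_idPr t0).
  apply: measurable_funTS.
  exact: (measurable_fun_pair2 om (measurable_C_reflected u)).
- by move=> t /itv0 t0; rewrite lee_fin !mulr_ge0 ?expR_ge0 ?regulator_ge0// ltW.
- apply/measurable_EFinP; apply: measurable_funM.
    by apply: measurable_funM => //; exact: measurable_discount.
  apply: measurable_funM => //; apply: measurable_nondecreasing_ge0 => s t.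
  exact: regulator_nondecreasing.
Qed.

Lemma integral_cst_discount (beta a : R) : 0 < beta -> 0 <= a ->
  (\int[mu]_(t in `[0%R, +oo[) (beta * expR (- (beta * t)) * a)%:E = a%:E)%E.
Proof.
move=> beta0 a0; rewrite -[RHS](_ : (a * expR (- (beta * 0)))%:E = _); last first.
  by rewrite mulr0 oppr0 expR0 mulr1.
rewrite -integral_discount_step//; apply: eq_integral => t; rewrite inE => t0.
by rewrite indicE mem_set// mulr1.
Qed.

Lemma path_cost_lower_bound (u : R) (om : T) : 0 <= u ->
  ((alpha^-1 * h u)%:E <= path_cost u om)%E.
Proof.
move=> u0; rewrite -(@integral_cst_discount alpha)//; last first.
  by rewrite mulr_ge0 ?h_ge0// invr_ge0 ltW.
apply: ge0_le_integral => //.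
- move=> t _; rewrite lee_fin !mulr_ge0 ?expR_ge0 ?h_ge0 ?invr_ge0//; exact: ltW.
- apply/measurable_EFinP; apply: measurable_funM => //.
  by apply: measurable_funM => //; exact: measurable_discount.
- by apply/measurable_EFinP; exact: measurable_cost_density_path.
move=> t /=; rewrite in_itv/= andbT => t0; rewrite lee_fin cost_densityE//.
rewrite mulrDr -addrA.
have -> : alpha * expR (- (alpha * t)) * (alpha^-1 * h u) = expR (- (alpha * t)) * h u.
  by rewrite mulrAC mulrA mulfV ?gt_eqF// mul1r mulrC.
rewrite lerDl addr_ge0//.
  by rewrite mulr_ge0 ?expR_ge0 ?C_ge0 ?reflected_ge0.
by rewrite !mulr_ge0 ?expR_ge0 ?regulator_ge0// ltW.
Qed.

(** The regulator costs at most [u t] more than for zero drift.  The constant 4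
    comes from [alpha t / 2 <= e^(alpha t / 2)], which bounds
    [alpha t e^(- alpha t)] by [2 e^(- alpha t / 2)], of integral
    [4 / alpha]. *)
Lemma path_cost_drift_bound (u : R) (om : T) : 0 <= u ->
  (path_cost u om <= path_cost 0 om +
     (alpha^-1 * (h u - h 0))%:E + (4 * p * u / alpha)%:E)%E.
Proof.
move=> u0.
have hu0 : 0 <= h u - h 0 by rewrite subr_ge0 h_nondecreasing ?in_itv/= ?andbT.
have a20 : 0 < alpha / 2 by rewrite divr_gt0.
have c1_ge0 : 0 <= alpha^-1 * (h u - h 0) by rewrite mulr_ge0// invr_ge0 ltW.
have c2_ge0 : 0 <= 4 * p * u / alpha by rewrite !mulr_ge0// invr_ge0 ltW.
have mc (beta a : R) : measurable_fun (`[0%R, +oo[ : set R)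
    (fun t => (beta * expR (- (beta * t)) * a)%:E).
  apply/measurable_EFinP; apply: measurable_funM => //.
  by apply: measurable_funM => //; exact: measurable_discount.
have c_ge0 (beta a t : R) : 0 < beta -> 0 <= a ->
    (0 <= (beta * expR (- (beta * t)) * a)%:E)%E.
  by move=> b0 a0; rewrite lee_fin !mulr_ge0 ?expR_ge0// ltW.
have m0 : measurable_fun (`[0%R, +oo[ : set R) (fun t => cost_density 0 (om, t)).
  exact: measurable_cost_density_path.
have d0 t : (0 <= (cost_density 0 (om, t))%:E)%E.
  by rewrite lee_fin cost_density_ge0.
rewrite -(integral_cst_discount alpha_gt0 c1_ge0) -(integral_cst_discount a20 c2_ge0).
rewrite -!ge0_integralD//; try by [move=> t _; exact: c_ge0|apply/measurable_EFinP].
- apply: ge0_le_integral => //.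
  + by move=> t _; rewrite lee_fin cost_density_ge0.
  + by apply/measurable_EFinP; exact: measurable_cost_density_path.
  + apply: emeasurable_funD; last exact: mc.
    by apply: emeasurable_funD; [exact/measurable_EFinP|exact: mc].
  move=> t /=; rewrite in_itv/= andbT => t0.
  rewrite -!EFinD lee_fin !cost_densityE//.
  set E := expR (- (alpha * t)).
  have E0 : 0 <= E by exact: expR_ge0.
  have EE : E = expR (- (alpha / 2 * t)) * expR (- (alpha / 2 * t)).
    by rewrite -expRD; congr expR; lra.
  have cancel : alpha * E * (alpha^-1 * (h u - h 0)) = E * (h u - h 0).
    by rewrite mulrAC mulrA mulfV ?gt_eqF// mul1r mulrC.
  have RC : C (reflected (path om) x u t) <= C (reflected (path om) x 0 t).
    rewrite C_nondecreasing ?in_itv/= ?andbT ?reflected_ge0//.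
    exact: reflected_anti_drift.
  have RL : regulator (path om) x u t <= regulator (path om) x 0 t + u * t.
    by have := regulator_drift_bound x (W_continuous (om := om)) u0 t0; rewrite subr0.
  have EC := ler_wpM2l E0 RC.
  have aE0 : 0 <= alpha * E * p by rewrite !mulr_ge0// ltW.
  have EL := ler_wpM2l aE0 RL.
  move: cancel EC EL; rewrite EE; set e := expR (- (alpha / 2 * t)).
  have ye : alpha / 2 * t * e <= 1.
    rewrite /e expRN ler_pdivrMr ?expR_gt0// mul1r.
    by apply: le_trans (expR_ge1Dx _); rewrite lerDr.
  have -> : alpha / 2 * e * (4 * p * u / alpha) = 2 * p * u * e.
    by field; rewrite gt_eqF.
  have : 2 * p * u * e * (alpha / 2 * t * e) <= 2 * p * u * e.
    by rewrite ler_piMr// !mulr_ge0 ?expR_ge0.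
  move: (regulator _ _ _ _) (regulator _ _ _ _) => L L0.
  move: (C _) (C _) => Cu C0 H1 H2 H3 H4; lra.
- by move=> t _; apply: adde_ge0 => //; exact: c_ge0.
- by apply: emeasurable_funD; [exact/measurable_EFinP|exact: mc].
- exact: mc.
- exact: mc.
Qed.

Lemma cost_density_continuous_drift (v : nat -> R) (u : R) (z : T * R) :
  (forall n, 0 <= v n) -> 0 <= u -> v n @[n --> \oo] --> u ->
  cost_density (v n) z @[n --> \oo] --> cost_density u z.
Proof.
move=> v0 u0 vu; rewrite /cost_density; set t := Num.max 0 z.2.
have t0 : 0 <= t by rewrite le_max lexx.
have regv : regulator (path z.1) x (v n) t @[n --> \oo] -->
    regulator (path z.1) x u t.
  have cr := @regulator_continuous_drift R (path z.1) x (@W_continuous z.1) t t0.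
  exact: (cvg_comp _ _ vu (cr u)).
have hv : h (v n) @[n --> \oo] --> h u.
  rewrite (_ : (fun n => h (v n)) = (fun n => h (Num.max 0 (v n)))); last first.
    by apply/funext => n; rewrite (max_idPr (v0 n)).
  rewrite -[in X in _ --> X](max_idPr u0).
  exact: (cvg_comp _ _ vu (continuous_extend_left h_continuous (x := u))).
have refv : reflected (path z.1) x (v n) t @[n --> \oo] -->
    reflected (path z.1) x u t.
  apply: cvgD => //; apply: cvgD; last exact: cvg_cst.
  by apply: cvgB; [exact: cvg_cst|apply: cvgM => //; exact: cvg_cst].
have Cv : C (reflected (path z.1) x (v n) t) @[n --> \oo] -->
    C (reflected (path z.1) x u t).
  have ref0 r : Num.max 0 (reflected (path z.1) x r t) = reflected (path z.1) x r t.
    by apply/max_idPr; exact: reflected_ge0.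
  rewrite (_ : (fun n => _) =
      (fun n => C (Num.max 0 (reflected (path z.1) x (v n) t)))); last first.
    by apply/funext => n; rewrite ref0.
  rewrite -(ref0 u).
  exact: (cvg_comp _ _ refv (continuous_extend_left C_continuous
    (x := reflected (path z.1) x u t))).
apply: cvgD; apply: cvgM.
- exact: cvg_cst.
- exact: cvgD.
- exact: cvg_cst.
- by apply: cvgM => //; exact: cvg_cst.
Qed.

(** Fatou's lemma in time. *)
Lemma path_cost_lower_semicontinuous (v : nat -> R) (u : R) (om : T) :
  (forall n, 0 <= v n) -> 0 <= u -> v n @[n --> \oo] --> u ->
  (path_cost u om <= limn_einf (fun n => path_cost (v n) om))%E.
Proof.
move=> v0 u0 vu.
have -> : path_cost u om = (\int[mu]_(t in `[0%R, +oo[)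
    limn_einf (fun n => (cost_density (v n) (om, t))%:E))%E.
  apply: eq_integral => t _; apply/esym; apply: (cvg_limn_einf_sup _).1.
  by apply: cvg_EFin; [near=> n|exact: cost_density_continuous_drift].
apply: (@fatou _ _ R mu _ _ (fun n t => (cost_density (v n) (om, t))%:E)) => //.
- by move=> n; apply/measurable_EFinP; exact: measurable_cost_density_path.
- by move=> n t _; rewrite lee_fin cost_density_ge0.
Unshelve. all: by end_near. Qed.

(** Fatou's lemma over the sample space, on top of the pathwise one. *)
Lemma discounted_cost_closed_sublevel (v : nat -> R) (u : R) (c : \bar R) :
  (forall n, 0 <= v n) -> v n @[n --> \oo] --> u ->
  (forall n, discounted_cost W h C p alpha x (v n) <= c)%E ->
  (discounted_cost W h C p alpha x u <= c)%E.
Proof.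
move=> v0 vu Jc.
have u0 : 0 <= u.
  by rewrite -(cvg_lim _ vu)//; apply: limr_ge; [exact: cvgP vu|exact: nearW].
rewrite discounted_costE//.
apply: (@le_trans _ _ (\int[P]_om limn_einf (fun n => path_cost (v n) om))%E).
  apply: ge0_le_integral => //.
  - by move=> om _; exact: path_cost_ge0.
  - exact: measurable_path_cost.
  - rewrite /limn_einf; apply: measurableT_comp => //.
    apply: measurable_fun_limn_esup => n; apply: measurableT_comp => //.
    exact: measurable_path_cost.
  - by move=> om _; exact: path_cost_lower_semicontinuous.
apply: le_trans (fatou P _ _ _) _ => //.
- by move=> n; exact: measurable_path_cost.
- by move=> n om _; exact: path_cost_ge0.
by apply: limn_einf_le_bound => n; rewrite -discounted_costE.
Qed.

Lemma discounted_cost_ge0 (u : R) : 0 <= u ->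
  (0 <= discounted_cost W h C p alpha x u)%E.
Proof.
by move=> u0; rewrite discounted_costE//; apply: integral_ge0 => om _; exact: path_cost_ge0.
Qed.

Lemma discounted_cost_lower_bound (u : R) : 0 <= u ->
  ((alpha^-1 * h u)%:E <= discounted_cost W h C p alpha x u)%E.
Proof.
move=> u0; rewrite discounted_costE//.
rewrite -[leLHS]mule1 -(probability_setT P) -integral_cst//.
apply: ge0_le_integral => //.
- by move=> om _; rewrite lee_fin mulr_ge0 ?h_ge0// invr_ge0 ltW.
- exact: measurable_path_cost.
- by move=> om _; exact: path_cost_lower_bound.
Qed.

Lemma discounted_cost_drift_bound (u : R) : 0 <= u ->
  (discounted_cost W h C p alpha x u <= discounted_cost W h C p alpha x 0 +
     (alpha^-1 * (h u - h 0) + 4 * p * u / alpha)%:E)%E.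
Proof.
move=> u0; rewrite !discounted_costE//.
rewrite -[X in (_ + X)%E]mule1 -(probability_setT P) -integral_cst//.
have hu0 : 0 <= h u - h 0 by rewrite subr_ge0 h_nondecreasing ?in_itv/= ?andbT.
have c0 : 0 <= alpha^-1 * (h u - h 0) + 4 * p * u / alpha.
  by rewrite addr_ge0// !mulr_ge0// invr_ge0 ltW.
rewrite -ge0_integralD//; last 2 first.
- by move=> om _; exact: path_cost_ge0.
- exact: measurable_path_cost.
apply: ge0_le_integral => //.
- by move=> om _; exact: path_cost_ge0.
- exact: measurable_path_cost.
- by apply: emeasurable_funD => //; exact: measurable_path_cost.
- by move=> om _; rewrite /cst EFinD addeA; exact: path_cost_drift_bound.
Qed.

(** Only the drift zero has to be approximated by positive ones, and
    [discounted_cost_drift_bound] makes the excess cost vanish with the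
    drift. *)
Lemma ereal_inf_positive_drift :
  ereal_inf [set discounted_cost W h C p alpha x u | u in [set u : R | 0 <= u]] =
  value_function W h C p alpha x.
Proof.
apply/eqP; rewrite eq_le; apply/andP; split.
  by apply: ereal_inf_le_tmp => _ [u /= u0 <-]; exists u => //=; exact: ltW.
apply: le_ereal_inf_tmp => _ [u /= u0 <-].
have [u_gt0|] := ltP 0 u; first by apply: ereal_inf_lbound; exists u.
move=> u_le0; have {u0 u_le0}-> : u = 0 by apply/eqP; rewrite eq_le u_le0.
apply/lee_addgt0Pr => e e0.
have ch : alpha^-1 * (h (Num.max 0 u) - h 0) + 4 * p * u / alpha @[u --> 0] --> (0 : R).
  rewrite [X in _ --> X](_ : 0 =
      alpha^-1 * (h (Num.max 0 0) - h 0) + 4 * p * 0 / alpha); last first.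
    by rewrite maxxx subrr !mulr0 mul0r addr0.
  apply: cvgD; apply: cvgM.
  - exact: cvg_cst.
  - apply: cvgB; last exact: cvg_cst.
    exact: (continuous_extend_left h_continuous (x := 0)).
  - by apply: cvgM; [exact: cvg_cst|exact: cvg_id].
  - exact: cvg_cst.
have [r /= r0 rP] : \forall u \near 0, 
    alpha^-1 * (h (Num.max 0 u) - h 0) + 4 * p * u / alpha <= e.
  move/cvgrPdist_le : ch => /(_ e e0); apply: filterS => {}u.
  by rewrite sub0r normrN; apply: le_trans; exact: ler_norm.
have r20 : 0 < r / 2 by rewrite divr_gt0.
have {}rP : alpha^-1 * (h (r / 2) - h 0) + 4 * p * (r / 2) / alpha <= e.
  have := rP (r / 2); rewrite (max_idPr (ltW r20)); apply.
  by rewrite /= sub0r normrN gtr0_norm// ltr_pdivrMr// ltr_pMr// ltr1n.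
apply: (@le_trans _ _ (discounted_cost W h C p alpha x (r / 2))).
  by apply: ereal_inf_lbound; exists (r / 2).
by apply: le_trans (discounted_cost_drift_bound (ltW r20)) _; rewrite leeD2l// lee_fin.
Qed.

End DiscountedCost.

Theorem theorem5p3 (R : realType) (d : measure_display)
    (T : measurableType d) (P : probability T R)
    (H : R) (H_range : 2^-1 <= H < 1)
    (W : R -> {RV P >-> R}) (W_fbm : fractional_brownian_motion H W)
    (p : R) (p_ge0 : 0 <= p)
    (h : R -> R)
    (h_ge0 : forall u, 0 <= u -> 0 <= h u)
    (h_continuous : {within `[0, +oo[, continuous h})
    (h_nondecreasing : {in `[0, +oo[ &, {homo h : u v / u <= v}})
    (h_convex : convex_function (`[0, +oo[%classic : set R) h)
    (h_infty : h u @[u --> +oo] --> +oo)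
    (C : R -> R)
    (C_ge0 : forall y, 0 <= y -> 0 <= C y)
    (C_continuous : {within `[0, +oo[, continuous C})
    (C_nondecreasing : {in `[0, +oo[ &, {homo C : y z / y <= z}})
    (C_convex : convex_function (`[0, +oo[%classic : set R) C)
    (C_growth : exists K gamma : R,
       [/\ 0 < K, 0 < gamma &
           forall y, 0 <= y -> C y <= K * (1 + y `^ gamma)])
    (alpha : R) (alpha_gt0 : 0 < alpha) :
  forall x : R, 0 <= x ->
    exists ustar : R,
      [/\ 0 <= ustar,
          discounted_cost W h C p alpha x ustar =
            ereal_inf [set discounted_cost W h C p alpha x u
                      | u in [set u : R | 0 <= u]] &
          ereal_inf [set discounted_cost W h C p alpha x u
                    | u in [set u : R | 0 <= u]] =
            value_function W h C p alpha x].
Proof.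
have [W_continuous W_start _ _ _] := W_fbm => x x_ge0.
have [ustar ustar0 Jmin] : exists2 u, 0 <= u & discounted_cost W h C p alpha x u =
    ereal_inf [set discounted_cost W h C p alpha x u | u in [set u : R | 0 <= u]].
  apply: (@closed_sublevel_coercive_attains_inf _ _ (fun u => alpha^-1 * h u)).
  - by move=> u u0; exact: discounted_cost_ge0.
  - by move=> u u0; exact: discounted_cost_lower_bound.
  - by apply: gt0_cvgMry => //; rewrite invr_gt0.
  - by move=> v u c; exact: discounted_cost_closed_sublevel.
exists ustar; split=> //.
exact: ereal_inf_positive_drift.
Qed.
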